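(* Let $\mathcal G$ be a second-countable ample groupoid and $S$ a semifield. Then the Steinberg algebra $A_S(\mathcal G)$ is congruence-simple if and only if all of the following hold: (1) $S$ is either a field or the Boolean semifield $\mathbb B$; (2) $\mathcal G$ is both minimal and effective; (3) for any two distinct elements $f,g\in A_S(\mathcal G)$, the set $\operatorname{Eq}(f,g)=\{\alpha\in\mathcal G: f(\alpha)=g(\alpha)\}$ is not dense in $\mathcal G$.
   Context: A semifield is a nontrivial commutative semiring (commutative monoid addition with $0$, commutative associative multiplication with $1$, distributivity, absorbing $0$) in which every nonzero element is invertible; $\mathbb B=(\{0,1\},\text{or},\text{and})$. An ample groupoid is a topological groupoid whose unit space $\mathcal G^{(0)}$ is locally compact Hausdorff and totally disconnected and whose source and range maps $s,r$ are local homeomorphisms ($\mathcal G$ need not be Hausdorff). $\mathcal G$ is minimal if $\mathcal G^{(0)}$ has no open invariant subsets other than $\varnothing$ and $\mathcal G^{(0)}$ (where $D\subseteq\mathcal G^{(0)}$ is invariant if $s(\gamma)\in D$ implies $r(\gamma)\in D$); $\mathcal G$ is effective if the interior of $\{\gamma: s(\gamma)=r(\gamma)\}$ equals $\mathcal G^{(0)}$. The Steinberg algebra $A_S(\mathcal G)$ is the set of functions $\mathcal G\to S$ of the form $\sum_{U\in F}s_U1_U$ with $F$ a finite set of compact open bisections (subsets on which $s,r$ are homeomorphisms onto their images), with pointwise addition and convolution $(f*g)(\gamma)=\sum_{\alpha\beta=\gamma}f(\alpha)g(\beta)$. A hemiring is congruence-simple if its only congruences (equivalence relations compatible with addition and left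 and right multiplication) are the full relation and the diagonal. *)

(* Defs.v *)
From HB Require Import structures.
From mathcomp Require Import all_boot all_order all_algebra.
From mathcomp Require Import all_classical.
From mathcomp Require Import topology.
Set Implicit Arguments.
Unset Strict Implicit.
Unset Printing Implicit Defensive.
Import Order.TTheory GRing.Theory.
Local Open Scope classical_set_scope.
Local Open Scope ring_scope.

(* Abstract groupoids.  Objects are identified with identity arrows,  *)
(* so the unit space G^(0) is a subset of G.  A pair (a,b) is         *)
(* composable iff src a = rng b, and then the product is gmul a b.    *)
Record groupoid (G : Type) := Groupoid {
  gsrc : G -> G;
  grng : G -> G;
  gmul : G -> G -> G;
  ginv : G -> G;
  gsrc_src : forall a, gsrc (gsrc a) = gsrc a;
  grng_src : forall a, grng (gsrc a) = gsrc a;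
  gsrc_rng : forall a, gsrc (grng a) = grng a;
  grng_rng : forall a, grng (grng a) = grng a;
  gsrc_mul : forall a b, gsrc a = grng b -> gsrc (gmul a b) = gsrc b;
  grng_mul : forall a b, gsrc a = grng b -> grng (gmul a b) = grng a;
  gmulA : forall a b c, gsrc a = grng b -> gsrc b = grng c ->
     gmul (gmul a b) c = gmul a (gmul b c);
  gmul_rng : forall a, gmul (grng a) a = a;
  gmul_src : forall a, gmul a (gsrc a) = a;
  gsrc_inv : forall a, gsrc (ginv a) = grng a;
  grng_inv : forall a, grng (ginv a) = gsrc a;
  gmulV : forall a, gmul a (ginv a) = grng a;
  gmulVl : forall a, gmul (ginv a) a = gsrc a
}.

Section GroupoidDefs.
Variable G : topologicalType.
Variable Gd : groupoid G.

Definition unit_space : set G := [set u | gsrc Gd u = u].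

Definition open_in (A B : set G) := exists V : set G, open V /\ B = V `&` A.

Definition topological_groupoid :=
  {within [set p : G * G | gsrc Gd p.1 = grng Gd p.2],
     continuous (fun p : G * G => gmul Gd p.1 p.2)} /\
  continuous (ginv Gd).

Definition local_homeo_to_units (f : G -> G) :=
  forall x, exists U : set G,
    [/\ open U /\ U x,
        open_in unit_space (f @` U),
        (forall y z, U y -> U z -> f y = f z -> y = z),
        {within U, continuous f} &
        (forall W, open W -> W `<=` U -> open_in unit_space (f @` W))].

Definition units_hausdorff :=
  forall x y, unit_space x -> unit_space y -> x <> y ->
    exists U V : set G, [/\ open U, open V, U x, V y &
                            U `&` V `&` unit_space = set0].

Definition units_locally_compact :=
  forall x, unit_space x ->
    exists U K : set G, [/\ open U, U x, compact K, K `<=` unit_space &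
                            U `&` unit_space `<=` K].

Definition ample :=
  [/\ topological_groupoid,
      units_locally_compact /\ units_hausdorff,
      totally_disconnected unit_space,
      local_homeo_to_units (gsrc Gd) & local_homeo_to_units (grng Gd)].

Definition invariant (D : set G) :=
  forall g, D (gsrc Gd g) -> D (grng Gd g).

Definition minimal :=
  forall D : set G, D `<=` unit_space -> open_in unit_space D -> invariant D ->
    D = set0 \/ D = unit_space.

Definition effective :=
  interior [set g | gsrc Gd g = grng Gd g] = unit_space.

Definition homeo_onto_image (f : G -> G) (U : set G) :=
  [/\ (forall y z, U y -> U z -> f y = f z -> y = z),
      {within U, continuous f} &
      (forall W, open W -> open_in (f @` U) (f @` (W `&` U)))].

Definition bisection (U : set G) :=
  homeo_onto_image (gsrc Gd) U /\ homeo_onto_image (grng Gd) U.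

Definition compact_open_bisection (U : set G) :=
  [/\ compact U, open U & bisection U].

Definition steinberg (S : comNzSemiRingType) : set (G -> S) :=
  [set f | exists (n : nat) (c : 'I_n -> S) (U : 'I_n -> set G),
     (forall i, compact_open_bisection (U i)) /\
     f = (fun x => \sum_(i < n) (if `[< U i x >] then c i else 0))].

Definition conv (S : comNzSemiRingType) (f g : G -> S) : G -> S :=
  fun gam => \sum_(p \in [set p : G * G | gsrc Gd p.1 = grng Gd p.2 /\
                                         gmul Gd p.1 p.2 = gam])
               (f p.1 * g p.2).

End GroupoidDefs.

Definition is_congruence (T : Type) (A : set T) (add mul : T -> T -> T)
    (R : T -> T -> Prop) :=
  [/\ (forall x y, R x y -> A x /\ A y),
      (forall x, A x -> R x x),
      (forall x y, R x y -> R y x),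
      (forall x y z, R x y -> R y z -> R x z) &
      (forall x y z, A z -> R x y ->
         [/\ R (add x z) (add y z), R (mul z x) (mul z y)
           & R (mul x z) (mul y z)])].

Definition congruence_simple (T : Type) (A : set T) (add mul : T -> T -> T) :=
  forall R, is_congruence A add mul R ->
    (forall x y, A x -> A y -> R x y) \/ (forall x y, R x y -> x = y).

Definition semifield (S : comNzSemiRingType) :=
  forall x : S, x != 0 -> exists y, x * y = 1.

Definition semiring_is_field (S : comNzSemiRingType) :=
  (forall x : S, exists y, x + y = 0) /\
  (forall x : S, x != 0 -> exists y, x * y = 1).

Definition is_boolean_semifield (S : comNzSemiRingType) :=
  exists phi : S -> bool,
    [/\ bijective phi, phi 0 = false, phi 1 = true,
        (forall x y, phi (x + y) = phi x || phi y) &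
        (forall x y, phi (x * y) = phi x && phi y)].

Arguments steinberg {G} Gd S.
Arguments conv {G} Gd {S} f g.

(* Main.v *)
(* Necessity. Each condition that fails yields a congruence which is neither the
   diagonal nor full: equality of supports if [S] is zero-sum-free, agreement on
   a dense open set, agreement off an open invariant set of units, and equality
   of the sums over all arrows from [y] to [x], which identifies [1_U] with
   [1_(s U)] whenever [U] consists of isotropy.

   Sufficiency. If [f] and [g] are congruent and distinct, they differ everywhere
   on some nonempty open set; translating by a bisection, they differ everywhere
   on a nonempty open set of units. Effectiveness allows one to shrink it to a
   compact open set [K] of units such that [1_K f 1_K = a 1_K] and
   [1_K g 1_K = b 1_K] with [a <> b], so [1_K] is congruent to [0], as [S] is a
   field or Boolean. By minimality the translates of [K] cover the unit space,
   hence every [1_U], and then every element, is congruent to [0]. *)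
Require Import Defs.
From HB Require Import structures.
From mathcomp Require Import all_boot all_order all_algebra.
From mathcomp Require Import all_classical.
From mathcomp Require Import topology.
Import GRing.Theory.
Local Open Scope classical_set_scope.
Local Open Scope ring_scope.

Set Implicit Arguments.
Unset Strict Implicit.
Unset Printing Implicit Defensive.

(** * Compact open sets in a totally disconnected space *)

(** Compactness as an induction principle. If [P K] fails, the sets [A] with [P (K \ A)] form a
    proper filter containing [K], and a cluster point of it in [K] contradicts the local
    hypothesis. *)
Lemma compact_ind (T : topologicalType) (K : set T) (P : set T -> Prop) :
  compact K -> P set0 -> (forall A B, A `<=` B -> P B -> P A) ->
  (forall A B, P A -> P B -> P (A `|` B)) ->
  (forall x, K x -> exists U, [/\ open U, U x & P (U `&` K)]) -> P K.
Proof.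
move=> cK P0 Psub PU Ploc; apply: contrapT => nPK.
pose F : set_system T := [set A | P (K `\` A)].
have FF : ProperFilter F.
  apply: Build_ProperFilter_ex.
    move=> A FA; apply: contrapT => A0; apply: nPK.
    by apply: Psub FA => x Kx; split=> // Ax; apply: A0; exists x.
  split.
  - by rewrite /F /= setDT.
  - by move=> A B FA FB; rewrite /F /= setDIr; exact: PU.
  - by move=> A B AB; apply: Psub => x [Kx nB]; split=> // /AB.
have [|x [Kx clx]] := cK F _; first by rewrite /F /= setDv.
have [U [oU Ux PUK]] := Ploc x Kx.
have [] := clx (~` U) U.
- by rewrite /F /=; apply: Psub PUK => y [Ky /contrapT].
- exact: open_nbhs_nbhs.
by move=> y [].
Qed.

Section RelativelyHausdorff.
Variables (T : topologicalType) (X : set T).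
Hypothesis oX : open X.
Hypothesis hX : forall x y, X x -> X y -> x <> y ->
  exists U V : set T, [/\ open U, open V, U x, V y & U `&` V = set0].

Lemma compact_point_separation (K : set T) y : compact K -> K `<=` X -> X y -> ~ K y ->
  exists U V : set T, [/\ open U, open V, K `<=` U, V y & U `&` V = set0].
Proof.
move=> cK KX Xy nKy.
pose P A := exists U V : set T, [/\ open U, open V, A `<=` U, V y & U `&` V = set0].
apply: (@compact_ind _ K P) => //.
- by exists set0, setT; split; [exact: open0|exact: openT|by []|by []|rewrite set0I].
- by move=> A B AB [U [V [oU oV BU Vy UV]]]; exists U, V; split=> // z /AB /BU.
- move=> A B [U [V [oU oV AU Vy UV]]] [U' [V' [oU' oV' AU' Vy' UV']]].
  exists (U `|` U'), (V `&` V'); split=> //; [exact: openU|exact: openI|..].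
    by move=> z [/AU|/AU']; [left|right].
  apply/seteqP; split=> // z [[Uz|Uz] [Vz Vz']].
    by rewrite -UV.
  by rewrite -UV'.
- move=> x Kx; have [|U [V [oU oV Ux Vy UV]]] := hX (KX _ Kx) Xy.
    by move=> xy; apply: nKy; rewrite -xy.
  by exists U; split=> //; exists U, V; split=> // z [].
Qed.

(** Points are separated only inside [X], so a compact set is closed relative to [X] but perhaps not
    in the whole space. *)
Lemma open_setD_compact (K : set T) : compact K -> K `<=` X -> open (X `\` K).
Proof.
move=> cK KX; rewrite openE => y [Xy nKy].
have [U [V [oU oV KU Vy UV]]] := compact_point_separation cK KX Xy nKy.
rewrite /interior nbhsE; exists (V `&` X).
  by split=> //; exact: openI.
move=> z [Vz Xz]; split=> // /KU Uz.
have : (U `&` V) z by [].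
by rewrite UV.
Qed.

Lemma compact_setD (K O : set T) : compact K -> open O -> compact (K `\` O).
Proof. by move=> cK oO; apply: compact_closedI => //; exact: open_closedC. Qed.

(** Intersections of compact sets can fail to be compact in a non-Hausdorff space. Inside [X] the
    intersection is [K] minus the open set [X \ L]. *)
Lemma compact_setI (K L : set T) : compact K -> compact L -> K `<=` X -> L `<=` X ->
  compact (K `&` L).
Proof.
move=> cK cL KX LX; have := compact_setD cK (open_setD_compact cL LX).
congr compact; apply/seteqP; split=> z [Kz].
  by move=> nL; split=> //; apply: contrapT => nLz; apply: nL; split=> //; exact: KX.
by move=> Lz; split=> // -[].
Qed.

Lemma compact_separation (K L : set T) : compact K -> compact L -> K `<=` X -> L `<=` X ->
  K `&` L = set0 ->
  exists U V : set T, [/\ open U, open V, K `<=` U, L `<=` V & U `&` V = set0].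
Proof.
move=> cK cL KX LX KL.
pose P A := exists U V : set T, [/\ open U, open V, K `<=` U, A `<=` V & U `&` V = set0].
apply: (@compact_ind _ L P) => //.
- by exists setT, set0; split; [exact: openT|exact: open0|by []|by []|rewrite setI0].
- by move=> A B AB [U [V [oU oV KU BV UV]]]; exists U, V; split=> // z /AB /BV.
- move=> A B [U [V [oU oV KU AV UV]]] [U' [V' [oU' oV' KU' BV UV']]].
  exists (U `&` U'), (V `|` V'); split=> //; [exact: openI|exact: openU|..].
  + by move=> z Kz; split; [exact: KU|exact: KU'].
  + by move=> z [/AV|/BV]; [left|right].
  apply/seteqP; split=> // z [[Uz Uz'] [Vz|Vz]].
    by rewrite -UV.
  by rewrite -UV'.
- move=> y Ly; have nKy : ~ K y by move=> Ky; have : (K `&` L) y by []; rewrite KL.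
  have [U [V [oU oV KU Vy UV]]] := compact_point_separation cK KX (LX _ Ly) nKy.
  by exists V; split=> //; exists U, V; split=> // z [].
Qed.

(* Relatively clopen subsets of a compact [K] are encoded as the compact
   subsets with compact complement in [K]; [Q] is the quasi-component of [x]. *)
Lemma quasicomponent_connected (K : set T) x : compact K -> K `<=` X -> K x ->
  let CC := [set C | [/\ C `<=` K, compact C, compact (K `\` C) & C x]] in
  let Q := \bigcap_(C in CC) C in
  connected Q /\ (forall U, open U -> Q `<=` U -> exists2 C, CC C & C `<=` U).
Proof.
move=> cK KX Kx CC Q.
have CCK : CC K by split=> //; rewrite setDv; exact: compact0.
have CCI A B : CC A -> CC B -> CC (A `&` B).
  move=> [AK cA cKA Ax] [BK cB cKB Bx]; split=> //.
  - by move=> z [/AK].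
  - by apply: compact_setI => // z; [move=> /AK/KX|move=> /BK/KX].
  - by rewrite setDIr; exact: compactU.
have QK : Q `<=` K by move=> z; apply.
have Qx : Q x by move=> C [].
have shrink U : open U -> Q `<=` U -> exists2 C, CC C & C `<=` U.
  move=> oU QU.
  pose P A := exists2 C, CC C & C `&` A = set0.
  have [|||||C CCC CKU] := @compact_ind _ (K `\` U) P.
  - exact: compact_setD.
  - by exists K => //; rewrite setI0.
  - move=> A B AB [C CCC CB]; exists C => //; apply/seteqP; split=> // z [Cz /AB Bz].
    by rewrite -CB.
  - move=> A B [C CCC CA] [C' CCC' CB]; exists (C `&` C'); first exact: CCI.
    by apply/seteqP; split=> // z [[Cz Cz'] [Az|Bz]]; [rewrite -CA|rewrite -CB].
  - move=> y [Ky nUy]; have [C [CCC nCy]] : exists C, CC C /\ ~ C y.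
      apply: contrapT => nC; apply/nUy/QU => C CCC.
      by apply: contrapT => nCy; apply: nC; exists C.
    have [CK cC _ _] := CCC.
    have [V [W [oV oW CV Wy VW]]] :=
      compact_point_separation cC (subset_trans CK KX) (KX _ Ky) nCy.
    exists W; split=> //; exists C => //; apply/seteqP; split=> // z [/CV Vz [Wz _]].
    by rewrite -VW.
  exists C => // z Cz; apply: contrapT => nUz.
  have [CK _ _ _] := CCC; suff : (C `&` (K `\` U)) z by rewrite CKU.
  by split=> //; split=> //; exact: CK.
split=> // B B0 [C1 oC1 BC1] [C2 clC2 BC2].
have cQ : compact Q.
  suff -> : Q = K `\` \bigcup_(C in CC) (X `\` C).
    apply: compact_setD => //; apply: bigcup_open => C [CK cC _ _].
    by apply: open_setD_compact => //; exact: subset_trans KX.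
  apply/seteqP; split=> [z Qz|z [Kz nz] C CCC].
    by split=> [|[C CCC [_]]]; [exact: QK|apply; exact: Qz].
  by apply: contrapT => nCz; apply: nz; exists C => //; split=> //; exact: KX.
have cB : compact B by rewrite BC2; exact: compact_closedI.
have cQB : compact (Q `\` B).
  suff -> : Q `\` B = Q `\` C1 by exact: compact_setD.
  by rewrite BC1 setDIr setDv set0U.
have BQ : B `<=` Q by rewrite BC1 => z [].
have BX : B `<=` X by move=> z /BQ/QK/KX.
have QBX : Q `\` B `<=` X by move=> z [/QK/KX].
have [U [V [oU oV BU QBV UV]]] := compact_separation cB cQB BX QBX (setDIK _ _).
have [|z Qz|C CCC CUV] := shrink (U `|` V); first exact: openU.
  have [Bz|nBz] := pselect (B z); first by left; exact: BU.
  by right; apply: QBV.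
have [CK cC cKC Cx] := CCC.
(* When [C] splits along disjoint open sets, the piece containing [x] again belongs to [CC], hence
   contains all of [Q]. *)
have part A A' : open A -> open A' -> A `&` A' = set0 -> C `<=` A `|` A' -> A x ->
    Q `<=` A.
  move=> oA oA' AA' CA Ax; suff CCA : CC (C `&` A) by move=> z /(_ _ CCA) [].
  have eqA : C `&` A = C `\` A'.
    apply/seteqP; split=> z [Cz Az]; split=> //.
      by move=> A'z; have : (A `&` A') z by []; rewrite AA'.
    by have [] := CA z Cz.
  split=> //; first by move=> z [/CK].
    by rewrite eqA; exact: compact_setD.
  by rewrite setDIr; apply: compactU => //; exact: compact_setD.
have [Bx|nBx] := pselect (B x).
  have QU := part U V oU oV UV CUV (BU _ Bx).
  apply/seteqP; split=> // z Qz; apply: contrapT => nBz.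
  have : (U `&` V) z by split; [exact: QU|exact: QBV].
  by rewrite UV.
have QV : Q `<=` V by apply: (part V U oV oU); rewrite 1?setIC 1?setUC //; exact: QBV.
case: B0 => b Bb; have : (U `&` V) b by split; [exact: BU|apply: QV; exact: BQ].
by rewrite UV.
Qed.

Hypothesis lcX : forall x, X x -> exists U K : set T,
  [/\ open U, U x, compact K, K `<=` X & U `&` X `<=` K].
Hypothesis tdX : totally_disconnected X.

(** The quasi-component of [x] in a compact neighbourhood [K] is connected, hence equal to [{x}], so
    some relatively clopen [C] fits inside the given open set. It is open because [K \ C] is compact
    and [C] avoids the rim of [K]. *)
Lemma compact_open_base x O : X x -> open O -> O x ->
  exists W, [/\ compact W, open W, W x, W `<=` X & W `<=` O].
Proof.
move=> Xx oO Ox; have [U [K [oU Ux cK KX UK]]] := lcX Xx.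
have Kx : K x by exact: UK.
have /= [cQ shrink] := quasicomponent_connected cK KX Kx.
set Q := \bigcap_(_ in _) _ in cQ shrink.
have Qx : Q x by move=> C [].
have QX : Q `<=` X.
  move=> z /(_ K) Kz; apply/KX/Kz; split=> //; rewrite setDv; exact: compact0.
have Q1 : Q `<=` [set x] by rewrite -(tdX Xx); exact: connected_component_max.
have [|z /Q1 ->|C [CK cC cKC Cx] CO] := shrink ((U `&` X) `&` O).
- by apply: openI => //; exact: openI.
- by [].
exists C; split=> //; last 2 first.
- by move=> z /CK/KX.
- by move=> z /CO [].
suff -> : C = (U `&` X) `&` (X `\` (K `\` C)).
  by apply: openI; [exact: openI|apply: open_setD_compact => // z [/KX]].
apply/seteqP; split=> [z Cz|z [[Uz Xz] [_ nz]]].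
  by have [Uz Xz] := CO _ Cz; split=> //; split; [exact: KX (CK _ Cz)|case].
by apply: contrapT => nCz; apply: nz; split=> //; exact: UK.
Qed.

End RelativelyHausdorff.

(** * Ample groupoids *)

Section GroupoidAlgebra.
Variables (G : Type) (Gd : groupoid G).
Notation s := (gsrc Gd).
Notation r := (grng Gd).
Notation "a \*g b" := (gmul Gd a b) (at level 40, left associativity).
Notation "a ^v" := (ginv Gd a) (at level 3, format "a ^v").

Lemma ginvK a : (a^v)^v = a.
Proof.
rewrite -[LHS](gmul_src Gd) gsrc_inv grng_inv -(gmulVl Gd a) -gmulA ?gmulVl.
- by rewrite gsrc_inv gmul_rng.
- by rewrite gsrc_inv.
- by rewrite gsrc_inv.
Qed.

Lemma gmulK a b : s a = r b -> a^v \*g (a \*g b) = b.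
Proof. by move=> ab; rewrite -gmulA ?gsrc_inv// gmulVl ab gmul_rng. Qed.

Lemma gmulVK a b : r a = r b -> a \*g (a^v \*g b) = b.
Proof. by move=> ab; rewrite -gmulA ?grng_inv ?gsrc_inv// gmulV ab gmul_rng. Qed.

(** The opposite groupoid: source and range are exchanged. It turns statements about left
    convolution into statements about right convolution. *)
Definition gop : groupoid G.
Proof.
apply: (@Groupoid G r s (fun a b => b \*g a) (ginv Gd)) => *.
- exact: grng_rng.
- exact: gsrc_rng.
- exact: grng_src.
- exact: gsrc_src.
- exact: grng_mul.
- exact: gsrc_mul.
- by rewrite gmulA.
- exact: gmul_src.
- exact: gmul_rng.
- exact: grng_inv.
- exact: gsrc_inv.
- exact: gmulVl.
- exact: gmulV.
Defined.

End GroupoidAlgebra.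

Section AmpleOpposite.
Variables (G : topologicalType) (Gd : groupoid G).

Lemma unit_space_op : unit_space (gop Gd) = unit_space Gd.
Proof.
apply/seteqP; split=> u; rewrite /unit_space /= => <-.
  exact: gsrc_rng.
exact: grng_src.
Qed.

Lemma bisection_op U : bisection (gop Gd) U <-> bisection Gd U.
Proof. by split=> -[]; split. Qed.

Lemma compact_open_bisection_op U :
  compact_open_bisection (gop Gd) U <-> compact_open_bisection Gd U.
Proof. by split=> -[? ? /bisection_op]; split. Qed.

Lemma ample_op : ample Gd -> ample (gop Gd).
Proof.
move=> [[cM cV] [lc hX] td hs hr].
split; rewrite /local_homeo_to_units /units_locally_compact /units_hausdorff
  ?unit_space_op //; split=> //.
apply/subspace_continuousP => -[a b] /= ab N.
move/subspace_continuousP: cM => /(_ (b, a) (esym ab) N) h /h.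
rewrite !near_simpl /within /= => -[[A B] /= [Ab Ba] ABN].
exists (B, A) => //= -[x y] [/= Bx Ay] xy.
by apply: (ABN (y, x)).
Qed.

End AmpleOpposite.

(** * Local inverses of open maps *)

Section SectionMap.
Variables (T : topologicalType) (f : T -> T) (U : set T).
Hypothesis finj : forall y z, U y -> U z -> f y = f z -> y = z.

(** The inverse of [f] on [U]; outside the image of [U] it returns the default [y]. *)
Definition sect (y : T) : T := xget y [set a | U a /\ f a = y].

Lemma sectK a : U a -> sect (f a) = a.
Proof.
move=> Ua; rewrite /sect; case: xgetP => [b -> [Ub]|/(_ a)]; first exact: finj.
by case.
Qed.

Hypothesis fopen : forall W, open W -> open (f @` W).
Hypothesis oU : open U.

Lemma sect_continuous a : U a -> {for f a, continuous sect}.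
Proof.
move=> Ua; rewrite /prop_for /continuous_at (sectK Ua) => N.
rewrite {1}nbhsE => -[W [oW Wa] WN].
change (nbhs (f a) (sect @^-1` N)); rewrite nbhsE; exists (f @` (W `&` U)).
  by split; [apply: fopen; exact: openI|exists a].
by move=> _ [b [Wb Ub] <-]; rewrite /= sectK//; exact: WN.
Qed.

End SectionMap.

(** * Topology of an ample groupoid and its compact open bisections *)

Section Ample.
Variables (G : topologicalType) (Gd : groupoid G).
Hypothesis ampleG : ample Gd.
Notation s := (gsrc Gd).
Notation r := (grng Gd).
Notation "a \*g b" := (gmul Gd a b) (at level 40, left associativity).
Notation "a ^v" := (ginv Gd a) (at level 3, format "a ^v").
Notation X := (unit_space Gd).
Notation cob := (compact_open_bisection Gd).

Lemma unit_space_src a : X (s a). Proof. exact: gsrc_src. Qed.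

Lemma unit_space_rng a : X (r a). Proof. exact: gsrc_rng. Qed.

Lemma rng_unit u : X u -> r u = u.
Proof. by move=> Xu; rewrite -{1}Xu grng_src. Qed.

Lemma local_homeo_continuous f : local_homeo_to_units Gd f -> continuous f.
Proof.
move=> lf x; have [U [[oU Ux] _ _ + _]] := lf x.
by rewrite continuous_open_subspace// => /(_ x); apply; rewrite inE.
Qed.

Lemma continuous_src : continuous s.
Proof. by case: ampleG => _ _ _ ls _; exact: local_homeo_continuous. Qed.

Lemma continuous_rng : continuous r.
Proof. by case: ampleG => _ _ _ _ lr; exact: local_homeo_continuous. Qed.

Lemma continuous_inv : continuous (ginv Gd).
Proof. by case: ampleG => -[]. Qed.

Lemma open_src_preimage W : open W -> open (s @^-1` W).
Proof. by move=> oW; apply: open_comp => // x _; exact: continuous_src. Qed.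

Lemma open_rng_preimage W : open W -> open (r @^-1` W).
Proof. by move=> oW; apply: open_comp => // x _; exact: continuous_rng. Qed.

Lemma open_inv_preimage W : open W -> open ((ginv Gd) @^-1` W).
Proof. by move=> oW; apply: open_comp => // x _; exact: continuous_inv. Qed.

(* If [s] is injective on an open [U] then the units in [U] are exactly the
   [x \in U] with [s x \in U], because [s (s x) = s x]. *)
Lemma open_unit_space : open X.
Proof.
case: ampleG => _ _ _ ls _; rewrite openE => u Xu.
have [U [[oU Uu] _ sinj _ _]] := ls u.
rewrite /interior nbhsE; exists (U `&` s @^-1` U).
  by split; [apply: openI => //; exact: open_src_preimage|split=> //=; rewrite Xu].
by move=> x [Ux Usx]; apply: sinj => //; exact: gsrc_src.
Qed.

Lemma local_homeo_open f W : local_homeo_to_units Gd f -> open W -> open (f @` W).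
Proof.
move=> lf oW; rewrite openE => _ [x Wx <-].
have [U [[oU Ux] _ _ _ fo]] := lf x.
have [|z []//|V [oV eV]] := fo (W `&` U); first exact: openI.
rewrite /interior nbhsE; exists (f @` (W `&` U)); last by move=> _ [z [Wz _] <-]; exists z.
by split; [rewrite eV; apply: openI => //; exact: open_unit_space|exists x].
Qed.

Lemma open_src W : open W -> open (s @` W).
Proof. by case: ampleG => _ _ _ ls _; exact: local_homeo_open. Qed.

Lemma open_rng W : open W -> open (r @` W).
Proof. by case: ampleG => _ _ _ _ lr; exact: local_homeo_open. Qed.

Lemma unit_separation x y : X x -> X y -> x <> y ->
  exists U V : set G, [/\ open U, open V, U x, V y & U `&` V = set0].
Proof.
case: ampleG => _ [_ hX] _ _ _ Xx Xy xy.
have [U [V [oU oV Ux Vy UV]]] := hX x y Xx Xy xy.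
exists (U `&` X), V; split=> //; first by apply: openI => //; exact: open_unit_space.
by rewrite setIAC.
Qed.

Lemma compact_open_unit_base x O : X x -> open O -> O x ->
  exists W, [/\ compact W, open W, W x, W `<=` X & W `<=` O].
Proof.
case: ampleG => _ [lcX _] tdX _ _.
exact: (compact_open_base open_unit_space unit_separation lcX tdX).
Qed.

Lemma open_unit_spaceD K : compact K -> K `<=` X -> open (X `\` K).
Proof. exact: (open_setD_compact open_unit_space unit_separation). Qed.

(** Source and range are continuous and open on all of [G], so being a homeomorphism onto the image
    reduces to injectivity. *)
Lemma compact_open_bisectionE U : cob U <->
  [/\ compact U, open U, (forall y z, U y -> U z -> s y = s z -> y = z) &
      (forall y z, U y -> U z -> r y = r z -> y = z)].
Proof.
split=> [[cU oU [[? _ _] [? _ _]]]//|[cU oU si ri]]; split=> //; split; split=> //.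
- by apply: continuous_subspaceT; exact: continuous_src.
- move=> W oW; exists (s @` (W `&` U)); split; first by apply: open_src; exact: openI.
  by apply/seteqP; split=> [_ [x [Wx Ux] <-]|y []//]; split; exists x.
- by apply: continuous_subspaceT; exact: continuous_rng.
- move=> W oW; exists (r @` (W `&` U)); split; first by apply: open_rng; exact: openI.
  by apply/seteqP; split=> [_ [x [Wx Ux] <-]|y []//]; split; exists x.
Qed.

Lemma cob_src_inj U a b : cob U -> U a -> U b -> s a = s b -> a = b.
Proof. by move=> /compact_open_bisectionE[_ _ + _]; exact. Qed.

Lemma cob_rng_inj U a b : cob U -> U a -> U b -> r a = r b -> a = b.
Proof. by move=> /compact_open_bisectionE[_ _ _]; exact. Qed.

Lemma cob_units W : compact W -> open W -> W `<=` X -> cob W.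
Proof.
move=> cW oW WX; apply/compact_open_bisectionE; split=> // y z /WX yX /WX zX.
  by rewrite yX zX.
by rewrite !rng_unit.
Qed.

(** Shrink [O] until source and range are injective on it, choose a compact open set [K] of units
    around [s a] inside its source image, and lift [K] by the continuous inverse of [s]. *)
Lemma cob_base a O : open O -> O a -> exists U, [/\ cob U, U a & U `<=` O].
Proof.
move=> oO Oa; case: (ampleG) => _ _ _ ls lr.
have [U1 [[oU1 U1a] _ sinj _ _]] := ls a.
have [U2 [[oU2 U2a] _ rinj _ _]] := lr a.
pose O' := O `&` (U1 `&` U2).
have O'inj y z : O' y -> O' z -> s y = s z -> y = z.
  by move=> [_ [U1y _]] [_ [U1z _]]; exact: sinj.
have oO' : open O' by do 2 apply: openI => //.
have O'a : O' a by [].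
have [||K [cK oK Ka KX KO]] := @compact_open_unit_base (s a) (s @` O') (unit_space_src _).
- exact: open_src.
- by exists a.
exists (O' `&` s @^-1` K); split; last by move=> z [[]].
- apply/compact_open_bisectionE; split.
  + suff -> : O' `&` s @^-1` K = sect s O' @` K.
      apply: continuous_compact => //; apply: continuous_in_subspaceT => y.
      rewrite inE => /KO [b O'b <-].
      by apply: sect_continuous => //; exact: open_src.
    have sectO b : O' b -> sect s O' (s b) = b by exact: sectK.
    apply/seteqP; split=> [b [O'b Kb]|_ [y Ky <-]]; first by exists (s b) => //; exact: sectO.
    have [b O'b eb] := KO _ Ky.
    by rewrite -eb sectO//; split=> //=; rewrite eb.
  + by apply: openI => //; exact: open_src_preimage.
  + by move=> y z [[_ [? _]] _] [[_ [? _]] _]; exact: sinj.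
  + by move=> y z [[_ [_ ?]] _] [[_ [_ ?]] _]; exact: rinj.
- by [].
Qed.

Lemma inv_image U : (ginv Gd) @` U = (ginv Gd) @^-1` U.
Proof.
apply/seteqP; split=> [_ [a Ua <-]|a Ua]; first by rewrite /= ginvK.
by exists a^v => //; rewrite ginvK.
Qed.

Lemma cob_inv U : cob U -> cob ((ginv Gd) @^-1` U).
Proof.
move=> /compact_open_bisectionE[cU oU si ri]; apply/compact_open_bisectionE; split.
- rewrite -inv_image; apply: continuous_compact => //.
  by apply: continuous_subspaceT; exact: continuous_inv.
- exact: open_inv_preimage.
- by move=> y z Uy Uz yz; rewrite -(ginvK Gd y) -(ginvK Gd z); congr (ginv Gd _);
    apply: ri => //; rewrite !grng_inv.
- by move=> y z Uy Uz yz; rewrite -(ginvK Gd y) -(ginvK Gd z); congr (ginv Gd _);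
    apply: si => //; rewrite !gsrc_inv.
Qed.

Lemma compact_src U : compact U -> compact (s @` U).
Proof.
by apply: continuous_compact; apply: continuous_subspaceT; exact: continuous_src.
Qed.

Lemma compact_rng U : compact U -> compact (r @` U).
Proof.
by apply: continuous_compact; apply: continuous_subspaceT; exact: continuous_rng.
Qed.

Lemma cob_src U : cob U -> cob (s @` U).
Proof.
move=> /compact_open_bisectionE[cU oU _ _]; apply: cob_units.
- exact: compact_src.
- exact: open_src.
- by move=> _ [a _ <-]; exact: unit_space_src.
Qed.

(** Left translation by a bisection: [b] is multiplied by the only arrow of [U] composable with it.
    The value is meaningful only when [r b] is the source of an arrow of [U]. *)
Definition ltrans (U : set G) (b : G) : G := sect s U (r b) \*g b.

Lemma ltransE U a b : cob U -> U a -> s a = r b -> ltrans U b = a \*g b.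
Proof.
move=> /compact_open_bisectionE[_ _ si _] Ua ab.
by rewrite /ltrans -ab sectK.
Qed.

Lemma ltrans_continuous U a b : cob U -> U a -> s a = r b ->
  {for b, continuous (ltrans U)}.
Proof.
move=> bU Ua ab N; rewrite (ltransE bU Ua ab) => Nab.
have [_ oU si _] := (compact_open_bisectionE U).1 bU.
case: (ampleG) => -[/subspace_continuousP cM _] _ _ _ _.
have {}cM := cM (a, b) ab N Nab.
have cq : (fun b' => (sect s U (r b'), b')) @ b --> (a, b).
  have c1 : {for b, continuous (sect s U \o r)}.
    apply: continuous_comp; first exact: continuous_rng.
    by rewrite -ab; apply: sect_continuous => //; exact: open_src.
  move: c1; rewrite /prop_for /continuous_at /= -ab sectK// => c1.
  by apply: cvg_pair c1 _; exact: cvg_id.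
have := cq _ cM; rewrite /= !near_simpl /= => nb.
(* Multiplication is continuous only within the composable pairs, so [b'] is kept where an arrow of
   [U] composes with it. *)
have nU : nbhs b (r @^-1` (s @` U)).
  by apply: open_nbhs_nbhs; split; [exact/open_rng_preimage/open_src|exists a].
near=> b'; rewrite /ltrans.
have [a' Ua' a'b'] : (s @` U) (r b') by near: b'.
have : gsrc Gd (sect s U (r b')) = r b' by rewrite -a'b' sectK.
by near: b'.
Unshelve. all: by end_near. Qed.

(** The product set of [U] and [V], with [c = a b] solved for [b]; this is the form in which
    convolution with an indicator evaluates. *)
Definition bmul (U V : set G) := [set c | exists a, [/\ U a, r a = r c & V (a^v \*g c)]].

(** Near each of its points the product contains the preimage of [V] under translation by the
    inverse bisection of [U]. *)
Lemma open_bmul U V : cob U -> open V -> open (bmul U V).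
Proof.
move=> bU oV; rewrite openE => c [a [Ua ac Vac]].
have bU' := cob_inv bU.
have U'a : ((ginv Gd) @^-1` U) a^v by rewrite /= ginvK.
have sac : s a^v = r c by rewrite gsrc_inv.
have := ltrans_continuous bU' U'a sac.
move=> /(_ V); rewrite (ltransE bU' U'a sac) => /(_ (open_nbhs_nbhs (conj oV Vac))) nV.
have nU : nbhs c (r @^-1` (r @` U)).
  apply: open_nbhs_nbhs; split; last by exists a.
  by apply/open_rng_preimage/open_rng; case/compact_open_bisectionE: bU.
rewrite /interior; near=> c'.
have [a' Ua' a'c'] : (r @` U) (r c') by near: c'.
exists a'; split=> //; rewrite -(@ltransE _ a'^v c' bU') ?gsrc_inv//=; last by rewrite ginvK.
by near: c'.
Unshelve. all: by end_near. Qed.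

Lemma cob_bmul U V : cob U -> cob V -> cob (bmul U V).
Proof.
move=> bU bV; have [cU oU _ _] := (compact_open_bisectionE U).1 bU.
have [cV oV _ _] := (compact_open_bisectionE V).1 bV.
apply/compact_open_bisectionE; split; last 3 first.
- exact: open_bmul.
- move=> y z [a [Ua ay Vay]] [b [Ub bz Vbz]] yz.
  have e : a^v \*g y = b^v \*g z.
    by apply: (cob_src_inj bV Vay Vbz); rewrite !gsrc_mul ?gsrc_inv.
  have ab : a = b.
    by apply: (cob_src_inj bU Ua Ub); rewrite -!grng_inv -(grng_mul (b := y)) ?gsrc_inv// e
      grng_mul ?gsrc_inv.
  by rewrite -(gmulVK ay) e ab gmulVK.
- move=> y z [a [Ua ay Vay]] [b [Ub bz Vbz]] yz.
  have ab : a = b by apply: (cob_rng_inj bU Ua Ub); rewrite ay bz.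
  rewrite -(gmulVK ay) -(gmulVK bz) -ab; congr (_ \*g _).
  apply: (cob_rng_inj bV Vay); first by rewrite ab.
  by rewrite !grng_mul ?gsrc_inv// ab.
(* Compactness: the product is a continuous image of a relatively closed part of [V], the source
   image of [U] being compact and so closed in the unit space. *)
suff -> : bmul U V = ltrans U @` (V `&` r @^-1` (s @` U)).
  apply: continuous_compact.
    apply: continuous_in_subspaceT => b; rewrite inE => -[_ [a Ua ab]].
    exact: (ltrans_continuous bU Ua ab).
  apply: compact_closedI => //.
  suff -> : r @^-1` (s @` U) = ~` (r @^-1` (X `\` (s @` U))).
    apply: open_closedC; apply: open_rng_preimage; apply: open_unit_spaceD.
      exact: compact_src.
    by move=> _ [a _ <-]; exact: unit_space_src.
  apply/seteqP; split=> b; first by move=> Ub [].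
  by move=> nb; apply: contrapT => nUb; apply: nb; split=> //; exact: unit_space_rng.
apply/seteqP; split=> [c [a [Ua ac Vac]]|_ [b [Vb [a Ua ab]] <-]].
  have sac : s a = r (a^v \*g c) by rewrite grng_mul ?grng_inv// gsrc_inv.
  exists (a^v \*g c); first by split=> //; exists a.
  by rewrite (ltransE bU Ua sac) gmulVK.
rewrite (ltransE bU Ua ab); exists a; split=> //; first by rewrite grng_mul.
by rewrite gmulK.
Qed.

End Ample.

(** * Steinberg algebras *)

(** A sum of infinite support takes the default value 0, whence the two finiteness hypotheses; all
    three sums are compared over the union of the supports. *)
Lemma fsumD (I : choiceType) (S : nmodType) (P : set I) (f g : I -> S) :
  finite_set (P `&` [set i | f i <> 0]) -> finite_set (P `&` [set i | g i <> 0]) ->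
  \sum_(i \in P) (f i + g i) = \sum_(i \in P) f i + \sum_(i \in P) g i.
Proof.
move=> ff fg; pose Q := P `&` [set i | f i <> 0] `|` P `&` [set i | g i <> 0].
have QP : Q `<=` P by move=> i [[]|[]].
have nQ i : (P `\` Q) i -> f i = 0 /\ g i = 0.
  by move=> [Pi nQi]; split; apply: contrapT => n0; apply: nQi; [left|right].
have wid (h : I -> S) : (forall i, (P `\` Q) i -> h i = 0) -> \sum_(i \in P) h i = \sum_(i \in Q) h i.
  by move=> h0; apply/esym; apply: fsbig_widen.
rewrite !wid ?fsbig_split//; try by move=> i /nQ[].
  by rewrite finite_setU.
by move=> i /nQ[-> ->]; rewrite addr0.
Qed.

Section Steinberg.
Variables (G : topologicalType) (S : comNzSemiRingType).

Definition cind (c : S) (U : set G) : G -> S := fun x => if `[< U x >] then c else 0.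

Lemma cindT c U x : U x -> cind c U x = c.
Proof. by move=> Ux; rewrite /cind asboolT. Qed.

Lemma cindF c U x : ~ U x -> cind c U x = 0.
Proof. by move=> Ux; rewrite /cind asboolF. Qed.

Lemma cind_iff c U V x y : (U x <-> V y) -> cind c U x = cind c V y.
Proof. by move=> UV; rewrite /cind (asbool_equiv_eq UV). Qed.

Section OneGroupoid.
Variable Gd : groupoid G.
Notation A := (steinberg Gd S).
Notation cob := (compact_open_bisection Gd).
Notation s := (gsrc Gd).
Notation r := (grng Gd).
Notation "a \*g b" := (gmul Gd a b) (at level 40, left associativity).
Notation "a ^v" := (ginv Gd a) (at level 3, format "a ^v").

Lemma steinberg0 : A (fun=> 0).
Proof.
exists 0%N, (fun=> 0), (fun=> set0); split; first by case.
by apply/funext => x; rewrite big_ord0.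
Qed.

Lemma steinbergD f g : A f -> A g -> A (fun x => f x + g x).
Proof.
move=> [n [c [U [bU ->]]]] [m [d [V [bV ->]]]].
exists (n + m)%N, (fun i => match fintype.split i with inl j => c j | inr j => d j end),
  (fun i => match fintype.split i with inl j => U j | inr j => V j end); split.
  by move=> i; case: fintype.split.
apply/funext => x; rewrite big_split_ord /=; congr (_ + _); apply: eq_bigr => i _.
  by rewrite -[lshift m i]/(unsplit (inl i)) unsplitK.
by rewrite -[rshift n i]/(unsplit (inr i)) unsplitK.
Qed.

Lemma steinberg_cind c U : cob U -> A (cind c U).
Proof.
move=> bU; exists 1%N, (fun=> c), (fun=> U); split=> //.
by apply/funext => x; rewrite big_ord1.
Qed.

Lemma steinberg_ind (P : (G -> S) -> Prop) : P (fun=> 0) ->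
  (forall f c U, A f -> P f -> cob U -> P (fun x => f x + cind c U x)) ->
  forall f, A f -> P f.
Proof.
move=> P0 PD f [n [c [U [bU ->]]]].
elim: n c U bU => [|n IH] c U bU.
  suff -> : (fun x => \sum_(i < 0) (if `[< U i x >] then c i else 0)) = fun=> 0 by [].
  by apply/funext => x; rewrite big_ord0.
pose c' i := c (widen_ord (leqnSn n) i); pose U' i := U (widen_ord (leqnSn n) i).
have bU' i : cob (U' i) by exact: bU.
have -> : (fun x => \sum_(i < n.+1) (if `[< U i x >] then c i else 0)) =
    fun x => \sum_(i < n) (if `[< U' i x >] then c' i else 0) + cind (c ord_max) (U ord_max) x.
  by apply/funext => x; rewrite big_ord_recr.
by apply: PD => //; [exists n, c', U'|exact: IH].
Qed.

Hypothesis ampleG : ample Gd.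

(** A bisection meets each fibre of the range map in at most one arrow. *)
Lemma finite_rng_fibre f x : A f -> finite_set [set a | r a = x /\ f a <> 0].
Proof.
move: f; apply: steinberg_ind => [|f c U Af ff bU].
  by apply: (@sub_finite_set _ _ set0) => // a [].
have fU : finite_set [set a | r a = x /\ U a].
  have [[b [Ub rb]]|nb] := pselect (exists b, U b /\ r b = x).
    apply: (@sub_finite_set _ _ [set b]); last exact: finite_set1.
    by move=> a [ra Ua]; apply: (cob_rng_inj ampleG bU) => //; rewrite ra.
  by apply: (@sub_finite_set _ _ set0) => // a [ra Ua]; apply: nb; exists a.
apply: (@sub_finite_set _ _ ([set a | r a = x /\ f a <> 0] `|` [set a | r a = x /\ U a]));
  last by rewrite finite_setU.
move=> a [ra fa]; have [Ua|nUa] := pselect (U a); first by right.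
by left; split=> //; rewrite cindF // addr0 in fa.
Qed.

(** A factorization of [c] is determined by its first factor, which lies in the fibre over [r c].
    Convolution sums are therefore finite. *)
Lemma finite_conv_support f g c : A f ->
  finite_set ([set p | s p.1 = r p.2 /\ p.1 \*g p.2 = c] `&`
              [set p | f p.1 * g p.2 <> 0]).
Proof.
move=> Af; apply: (@sub_finite_set _ _
  ((fun a => (a, a^v \*g c)) @` [set a | r a = r c /\ f a <> 0])); last first.
  exact/finite_image/finite_rng_fibre.
move=> [a b] /= [[ab <-] fg]; exists a; last by rewrite gmulK.
by split; [rewrite grng_mul|move=> fa; apply: fg; rewrite fa mul0r].
Qed.

Lemma convDl f g h : A f -> A g ->
  conv Gd (fun x => f x + g x) h = fun x => conv Gd f h x + conv Gd g h x.
Proof.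
move=> Af Ag; apply/funext => c; rewrite /conv -fsumD; try exact: finite_conv_support.
by apply: eq_fsbigr => p _; rewrite mulrDl.
Qed.

(** Only one term of the convolution survives, since [a] is the only arrow of [U] with range
    [r c]. *)
Lemma conv_cindT d U f a c : cob U -> U a -> r a = r c ->
  conv Gd (cind d U) f c = d * f (a^v \*g c).
Proof.
move=> bU Ua ac; rewrite /conv.
rewrite -(@fsbig_widen _ S 0 +%R [set (a, a^v \*g c)]); first by rewrite fsbig_set1 /= cindT.
  by move=> _ -> /=; rewrite gmulVK// grng_mul ?grng_inv// gsrc_inv.
move=> [a' b] /= [[ab abc] ne]; have [Ua'|nU] := pselect (U a'); last by rewrite cindF ?mul0r.
have ea : a' = a by apply: (cob_rng_inj ampleG bU) => //; rewrite ac -abc grng_mul.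
by exfalso; apply: ne; rewrite -abc -ea gmulK.
Qed.

Lemma conv_cindF d U f c : (forall a, U a -> r a <> r c) -> conv Gd (cind d U) f c = 0.
Proof.
move=> nU; apply: fsbig1 => -[a b] /= [ab abc].
by rewrite cindF ?mul0r// => /nU; apply; rewrite -abc grng_mul.
Qed.

Lemma conv0l f : conv Gd (fun=> 0) f = fun=> 0 :> S.
Proof. by apply/funext => c; apply: fsbig1 => p _; rewrite mul0r. Qed.

Lemma conv_cind_cind c d U V : cob U -> cob V ->
  conv Gd (cind c U) (cind d V) = cind (c * d) (bmul Gd U V).
Proof.
move=> bU bV; apply/funext => x.
have [[a [Ua ax]]|na] := pselect (exists a, U a /\ r a = r x); last first.
  rewrite conv_cindF => [|a Ua ax]; last by apply: na; exists a.
  by rewrite cindF// => -[a [Ua ax _]]; apply: na; exists a.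
rewrite (conv_cindT _ _ bU Ua ax).
have [Vx|nV] := pselect (V (a^v \*g x)).
  by rewrite !cindT//; exists a.
rewrite !cindF ?mulr0// => -[b [Ub bx Vb]].
by apply: nV; rewrite (cob_rng_inj ampleG bU Ua Ub)// ax.
Qed.

Lemma conv_cindDr d U f g : cob U ->
  conv Gd (cind d U) (fun x => f x + g x) =
  fun x => conv Gd (cind d U) f x + conv Gd (cind d U) g x.
Proof.
move=> bU; apply/funext => x.
have [[a [Ua ax]]|na] := pselect (exists a, U a /\ r a = r x).
  by rewrite !(conv_cindT _ _ bU Ua ax) mulrDr.
by rewrite !conv_cindF ?addr0// => a Ua ax; apply: na; exists a.
Qed.

Lemma conv_cind0 d U : cob U -> conv Gd (cind d U) (fun=> 0) = fun=> 0.
Proof. by move=> bU; apply/funext => x; apply: fsbig1 => p _; rewrite mulr0. Qed.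

Lemma steinberg_conv f g : A f -> A g -> A (conv Gd f g).
Proof.
move=> Af Ag; move: f Af; apply: steinberg_ind => [|f c U Af Afg bU].
  by rewrite conv0l; exact: steinberg0.
rewrite convDl//; last exact: steinberg_cind.
apply: steinbergD => //; move: g Ag {Afg}; apply: steinberg_ind => [|g d V Ag Afg bV].
  by rewrite conv_cind0//; exact: steinberg0.
rewrite conv_cindDr//; apply: steinbergD => //.
rewrite conv_cind_cind//; apply: steinberg_cind; exact: cob_bmul.
Qed.

(** The left factor is a finite sum of multiples of indicators, and the summands of the product are
    replaced one at a time; so convolution with a single such term is all that must be tested. *)
Lemma conv_left_compatible (R : (G -> S) -> (G -> S) -> Prop) :
  (forall f, A f -> R f f) ->
  (forall f g h, R f g -> R g h -> R f h) ->
  (forall f g, R f g -> R g f) ->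
  (forall f g, R f g -> A f /\ A g) ->
  (forall f g h, A h -> R f g -> R (fun x => f x + h x) (fun x => g x + h x)) ->
  (forall c U f g, cob U -> R f g -> R (conv Gd (cind c U) f) (conv Gd (cind c U) g)) ->
  forall h f g, A h -> R f g -> R (conv Gd h f) (conv Gd h g).
Proof.
move=> Rr Rt Rs RA Radd Rc h f g Ah Rfg; have [Af Ag] := RA _ _ Rfg.
move: h Ah; apply: steinberg_ind => [|h c U Ah Rh bU].
  by rewrite !conv0l; apply: Rr; exact: steinberg0.
have AU := steinberg_cind c bU.
rewrite !convDl//; apply: (Rt _ (fun x => conv Gd h g x + conv Gd (cind c U) f x)).
  by apply: Radd => //; exact: steinberg_conv.
have addC (u v : G -> S) : (fun x => u x + v x) = fun x => v x + u x.
  by apply/funext => x; rewrite addrC.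
rewrite addC (addC (conv Gd h g)); apply: Radd; first exact: steinberg_conv.
exact: Rc.
Qed.

End OneGroupoid.

(** * Congruences tested on indicators, from both sides *)

Section Congruences.
Variable Gd : groupoid G.
Hypothesis ampleG : ample Gd.
Notation A := (steinberg Gd S).
Notation cob := (compact_open_bisection Gd).

(** Reversing the factorizations reverses the order of the coefficients, which commute in [S]. *)
Lemma conv_op f g : conv (gop Gd) f g = conv Gd g f :> (G -> S).
Proof.
apply/funext => c; rewrite /conv.
rewrite (@reindex_fsbig _ _ _ _ _ (fun p : G * G => (p.2, p.1))
  [set p : G * G | gsrc Gd p.1 = grng Gd p.2 /\ gmul Gd p.1 p.2 = c]).
  by apply: eq_fsbigr => p _; rewrite /= mulrC.
split.
- by move=> [a b] /= [ab <-].
- by move=> [a b] [a' b'] _ _ /= [-> ->].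
- by move=> [a b] /= [ab e]; exists (b, a).
Qed.

Lemma steinberg_op : steinberg (gop Gd) S = A.
Proof.
by apply/seteqP; split=> f [n [c [U [bU ->]]]]; exists n, c, U; split=> // i;
  apply/compact_open_bisection_op.
Qed.

Lemma is_congruence_cind (R : (G -> S) -> (G -> S) -> Prop) :
  (forall f g, R f g -> A f /\ A g) ->
  (forall f, A f -> R f f) ->
  (forall f g, R f g -> R g f) ->
  (forall f g h, R f g -> R g h -> R f h) ->
  (forall f g h, A h -> R f g -> R (fun x => f x + h x) (fun x => g x + h x)) ->
  (forall c U f g, cob U -> R f g -> R (conv Gd (cind c U) f) (conv Gd (cind c U) g)) ->
  (forall c U f g, compact_open_bisection (gop Gd) U -> R f g ->
     R (conv (gop Gd) (cind c U) f) (conv (gop Gd) (cind c U) g)) ->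
  is_congruence A (fun f g x => f x + g x) (conv Gd) R.
Proof.
move=> RA Rr Rs Rt Radd Rl Rri; split=> // f g h Ah Rfg; split.
- exact: Radd.
- exact: (conv_left_compatible ampleG).
- rewrite -!conv_op; apply: (conv_left_compatible (ample_op ampleG)); rewrite ?steinberg_op//.
Qed.

End Congruences.
End Steinberg.

(** * Sufficiency *)

Section SimplicitySufficient.
Variables (G : topologicalType) (S : comNzSemiRingType) (Gd : groupoid G).
Hypothesis ampleG : ample Gd.
Notation A := (steinberg Gd S).
Notation cob := (compact_open_bisection Gd).
Notation s := (gsrc Gd).
Notation r := (grng Gd).
Notation X := (unit_space Gd).
Notation "a \*g b" := (gmul Gd a b) (at level 40, left associativity).
Notation "a ^v" := (ginv Gd a) (at level 3, format "a ^v").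

Lemma effective_open N : effective Gd -> open N ->
  (forall a, N a -> s a = r a) -> N `<=` X.
Proof.
by move=> <- oN NI a Na; rewrite /interior nbhsE; exists N.
Qed.

(** If some arrow of [U] starting in [W] has distinct source and range, these are separated by open
    sets, and on a small set around the source every arrow of [U] leaves that set. Otherwise the
    part of [U] over [W] is open isotropy, hence consists of units. *)
Lemma bisection_shrink U W : effective Gd -> cob U -> open W -> W !=set0 -> W `<=` X ->
  exists W', [/\ open W', W' !=set0, W' `<=` W &
    forall a, U a -> W' (s a) -> W' (r a) -> X a].
Proof.
move=> eG bU oW W0 WX; have [_ oU _ _] := (compact_open_bisectionE ampleG U).1 bU.
have [[a [Ua Wa nIa]]|nI] := pselect (exists a, [/\ U a, W (s a) & s a <> r a]).
  have [P [Q [oP oQ Pa Qa PQ]]] :=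
    unit_separation ampleG (unit_space_src Gd a) (unit_space_rng Gd a) nIa.
  exists ((W `&` P) `&` s @` (U `&` r @^-1` Q)); split.
  - apply: openI; first exact: openI.
    by apply: open_src => //; apply: openI => //; exact: open_rng_preimage.
  - by exists (s a); split=> //; exists a.
  - by move=> z [[]].
  - move=> b Ub [_ [b' [Ub' Qb'] b'b]] [[_ Pb] _].
    have bb' := cob_src_inj ampleG bU Ub' Ub b'b.
    by exfalso; have : (P `&` Q) (r b); [split=> //; rewrite -bb'|rewrite PQ].
exists W; split=> // a Ua Wsa _.
apply: (@effective_open (U `&` s @^-1` W) eG); last by split.
  by apply: openI => //; exact: open_src_preimage.
by move=> b [Ub Wb]; apply: contrapT => nb; apply: nI; exists b.
Qed.

(* After shrinking, only the units contribute to the corner [1_W * f * 1_W]. *)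
Lemma steinberg_corner f : effective Gd -> A f ->
  forall W, open W -> W !=set0 -> W `<=` X ->
  exists W' a, [/\ open W', W' !=set0, W' `<=` W &
    forall c, W' (s c) -> W' (r c) -> f c = cind a X c].
Proof.
move=> eG; move: f; apply: steinberg_ind => [W oW W0 WX|f d U Af IH bU W oW W0 WX].
  by exists W, 0; split=> // c _ _; rewrite /cind; case: ifP.
have [W1 [a [oW1 W10 W1W fa]]] := IH W oW W0 WX.
have [W2 [oW2 W20 W2W1 UW2]] := bisection_shrink eG bU oW1 W10 (subset_trans W1W WX).
have [_ oU _ _] := (compact_open_bisectionE ampleG U).1 bU.
(* Either one restricts to units in [U], where the new term adds [d], or no unit of [W2] lies in [U]
   and the term vanishes. *)
have [[u [W2u Uu]]|nU] := pselect ((W2 `&` U) !=set0).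
  exists (W2 `&` U), (a + d); split; [exact: openI|by exists u|by move=> z [/W2W1/W1W]|].
  move=> c [Wsc Usc] [Wrc Urc]; rewrite (fa _ (W2W1 _ Wsc) (W2W1 _ Wrc)).
  have [Xc|nXc] := pselect (X c); last first.
    by rewrite !cindF ?addr0// => Uc; apply: nXc; exact: UW2.
  by rewrite !cindT//; rewrite /unit_space /= in Xc; rewrite -Xc.
exists W2, a; split=> //; first exact: subset_trans W1W.
move=> c Wsc Wrc; rewrite (fa _ (W2W1 _ Wsc) (W2W1 _ Wrc)) (@cindF _ _ d) ?addr0//.
move=> Uc; have Xc := UW2 _ Uc Wsc Wrc.
by apply: nU; exists c; split=> //; rewrite -Xc.
Qed.

Lemma conv_unitl K (c : S) f g : compact K -> open K -> K `<=` X ->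
  conv Gd (cind c K) f g = if `[< K (r g) >] then c * f g else 0.
Proof.
move=> cK oK KX; have bK := cob_units ampleG cK oK KX.
have [Kg|nK] := pselect (K (r g)).
  rewrite asboolT// (@conv_cindT _ _ _ ampleG _ _ _ (r g))// ?grng_rng//.
  by rewrite -{2}(gmul_rng Gd g) gmulK// gsrc_rng.
rewrite asboolF// conv_cindF// => a Ka; rewrite (rng_unit (KX _ Ka)) => ag.
by apply: nK; rewrite -ag.
Qed.

Lemma conv_units K L (c d : S) : compact K -> open K -> K `<=` X -> L `<=` X ->
  conv Gd (cind c K) (cind d L) = cind (c * d) (K `&` L).
Proof.
move=> cK oK KX LX; apply/funext => x; rewrite conv_unitl//.
have [Lx|nL] := pselect (L x).
  rewrite (rng_unit (LX _ Lx)) cindT//; apply: cind_iff.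
  by split=> [Kx|[]].
by rewrite !cindF ?mulr0 ?if_same// => -[].
Qed.

End SimplicitySufficient.

(** * A congruence relating two distinct elements is full *)

Section SimplicitySufficientMain.
Variables (G : topologicalType) (S : comNzSemiRingType) (Gd : groupoid G).
Hypothesis ampleG : ample Gd.
Notation A := (steinberg Gd S).
Notation cob := (compact_open_bisection Gd).
Notation s := (gsrc Gd).
Notation r := (grng Gd).
Notation X := (unit_space Gd).
Notation "a \*g b" := (gmul Gd a b) (at level 40, left associativity).
Notation "a ^v" := (ginv Gd a) (at level 3, format "a ^v").

Variable R : (G -> S) -> (G -> S) -> Prop.
Hypothesis congR : is_congruence A (fun f g x => f x + g x) (conv Gd) R.

Let z0 : G -> S := fun=> 0.

Let RA f g : R f g -> A f /\ A g. Proof. by case: congR => + _ _ _ _; exact. Qed.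
Let Rrefl f : A f -> R f f. Proof. by case: congR => _ + _ _ _; exact. Qed.
Let Rsym f g : R f g -> R g f. Proof. by case: congR => _ _ + _ _; exact. Qed.
Let Rtrans f g h : R f g -> R g h -> R f h.
Proof. by case: congR => _ _ _ + _; exact. Qed.
Let Radd f g h : A h -> R f g -> R (fun x => f x + h x) (fun x => g x + h x).
Proof. by case: congR => _ _ _ _ H Ah /H => /(_ _ Ah) []. Qed.
Let Rmull f g h : A h -> R f g -> R (conv Gd h f) (conv Gd h g).
Proof. by case: congR => _ _ _ _ H Ah /H => /(_ _ Ah) []. Qed.
Let Rmulr f g h : A h -> R f g -> R (conv Gd f h) (conv Gd g h).
Proof. by case: congR => _ _ _ _ H Ah /H => /(_ _ Ah) []. Qed.

Let add0f (f : G -> S) : (fun x => z0 x + f x) = f.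
Proof. by apply/funext => x; rewrite add0r. Qed.

Lemma cind_set0 (c : S) : cind c set0 = z0.
Proof. by apply/funext => x; rewrite cindF. Qed.

Lemma cind0 U : cind 0 U = z0.
Proof. by apply/funext => x; rewrite /cind if_same. Qed.

Lemma congruence_left0 f h : A h -> R f z0 -> R (conv Gd h f) z0.
Proof.
move=> Ah /(Rmull Ah); rewrite (_ : conv Gd h z0 = z0)//.
by apply/funext => c; apply: fsbig1 => p _; rewrite mulr0.
Qed.

Lemma congruence_right0 f h : A h -> R f z0 -> R (conv Gd f h) z0.
Proof. by move=> Ah /(Rmulr Ah); rewrite conv0l. Qed.

Lemma congruence_full K : minimal Gd -> compact K -> open K -> K !=set0 -> K `<=` X ->
  R (cind 1 K) z0 -> forall f g, A f -> A g -> R f g.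
Proof.
move=> mG cK oK [k Kk] KX RK.
(* The saturation of [K] is open, invariant and nonempty, so minimality applies. *)
have sat : r @` (s @^-1` K) = X.
  case: (mG (r @` (s @^-1` K))) => //.
  - by move=> _ [a _ <-]; exact: unit_space_rng.
  - exists (r @` (s @^-1` K)); split.
      by apply: open_rng => //; exact: open_src_preimage.
    by apply/seteqP; split=> [_ [a Ka <-]|z []//]; split; [exists a|exact: unit_space_rng].
  - move=> g [a Ka ag]; exists (g \*g a); last by rewrite grng_mul.
    by rewrite /= gsrc_mul.
  - by move=> E; have : (r @` (s @^-1` K)) (r k); [exists k => //=; rewrite (KX _ Kk)|rewrite E].
have local x : X x ->
    exists V, [/\ compact V, open V, V x, V `<=` X & R (cind 1 V) z0].
  rewrite -{1}sat => -[a Ka <-].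
  have [||B [bB Ba BK]] := @cob_base _ _ ampleG a (s @^-1` K).
  - exact: open_src_preimage.
  - by [].
  have [cB oB _ _] := (compact_open_bisectionE ampleG B).1 bB.
  (* As the sources of [B] lie in [K], the indicator of [B] equals its product with that of [K].
     Multiplying next by the inverse bisection gives the indicator of the range of [B]. *)
  have RB : R (cind 1 B) z0.
    have := congruence_left0 (steinberg_cind 1 bB) RK.
    rewrite (conv_cind_cind ampleG)//; last exact: cob_units.
    rewrite mulr1; congr (R (cind 1 _) _); apply/seteqP; split=> c.
      move=> [b [Bb bc Kbc]]; suff -> : c = b by [].
      rewrite -[LHS](gmulVK bc) -[RHS](gmul_src Gd b); congr (_ \*g _).
      by rewrite -(rng_unit (KX _ Kbc)) grng_mul ?gsrc_inv// grng_inv.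
    by move=> Bc; exists c; split=> //; rewrite gmulVl; exact: BK.
  have := congruence_right0 (steinberg_cind 1 (cob_inv ampleG bB)) RB.
  rewrite (conv_cind_cind ampleG)//; last exact: cob_inv.
  rewrite mulr1 => RrB; exists (r @` B); split.
  - exact: compact_rng.
  - exact: open_rng.
  - by exists a.
  - by move=> _ [b _ <-]; exact: unit_space_rng.
  move: RrB; congr (R (cind 1 _) _); apply/seteqP; split=> [c [b [Bb bc Bbc]]|_ [b Bb <-]].
    pose d := b^v \*g c; have sbd : s b = r d by rewrite grng_mul ?grng_inv// gsrc_inv.
    have e : d^v = b by apply: (cob_src_inj ampleG bB) => //; rewrite gsrc_inv.
    have cd : c = s d by rewrite -(gmulVK bc) -/d -{1}e gmulVl.
    by exists b => //; rewrite bc cd grng_src.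
  by exists b; split; rewrite ?grng_rng//= -(gsrc_inv Gd b) gmul_src ginvK.
pose P L := exists V, [/\ compact V, open V, L `<=` V, V `<=` X & R (cind 1 V) z0].
have PK L : compact L -> L `<=` X -> P L.
  move=> cL LX; apply: compact_ind => //.
  - exists set0; split=> //; [exact: compact0|exact: open0|].
    by rewrite cind_set0; apply: Rrefl; exact: steinberg0.
  - by move=> B C BC [V [cV oV CV VX RV]]; exists V; split=> //; exact: subset_trans CV.
  - move=> B C [V [cV oV BV VX RV]] [W [cW oW CW WX RW]].
    have cWV : compact (W `\` V) by exact: compact_setD.
    have oWV : open (W `\` V).
      have -> : W `\` V = W `&` (X `\` V).
        by apply/seteqP; split=> z [Wz]; [move=> nV; split=> //; split=> //; exact: WX|case].
      by apply: openI => //; exact: open_unit_spaceD.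
    have WVX : W `\` V `<=` X by move=> z [/WX].
    have AWV : A (cind 1 (W `\` V)) by apply: steinberg_cind; exact: cob_units.
    exists (V `|` W); split=> //; [exact: compactU|exact: openU|..].
    + by move=> z [/BV|/CW]; [left|right].
    + by move=> z [/VX|/WX].
    have -> : cind 1 (V `|` W) = fun x => cind 1 V x + cind 1 (W `\` V) x :> S.
      apply/funext => x; have [Vx|nVx] := pselect (V x).
        rewrite cindT; last by left.
        by rewrite cindT// cindF ?addr0// => -[].
      rewrite (@cindF _ _ _ V)// add0r; apply: cind_iff.
      by split=> [[|]|[]]//; right.
    apply: Rtrans (Radd AWV RV) _; rewrite add0f.
    have := congruence_left0 AWV RW; rewrite conv_units// mulr1.
    by congr (R (cind 1 _) _); apply/seteqP; split=> [z []|z [Wz nV]].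
  - move=> x Lx; have [V [cV oV Vx VX RV]] := local x (LX _ Lx).
    by exists V; split=> //; exists V; split=> // z [].
(* If [V] contains the ranges of [U], the indicator of [V] acts as a left identity on [cind c U]. *)
have RU c U : cob U -> R (cind c U) z0.
  move=> bU; have [cU oU _ _] := (compact_open_bisectionE ampleG U).1 bU.
  have [||V [cV oV UV VX RV]] := PK (r @` U).
  - exact: compact_rng.
  - by move=> _ [a _ <-]; exact: unit_space_rng.
  have := congruence_right0 (steinberg_cind c bU) RV.
  congr (R _ _); apply/funext => x; rewrite conv_unitl// mul1r.
  have [Ux|nU] := pselect (U x); last by rewrite cindF// if_same.
  by rewrite asboolT//; apply: UV; exists x.
have Rf f : A f -> R f z0.
  move: f; apply: steinberg_ind => [|f c U Af Rf bU]; first by apply: Rrefl; exact: steinberg0.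
  apply: Rtrans (Radd (steinberg_cind c bU) Rf) _.
  by rewrite add0f; exact: RU.
by move=> f g Af Ag; apply: Rtrans (Rf _ Af) _; exact/Rsym/Rf.
Qed.

Lemma congruence_full_of_neq f g : semiring_is_field S \/ is_boolean_semifield S ->
  minimal Gd -> effective Gd ->
  (forall f g : G -> S, A f -> A g -> f <> g -> ~ dense [set a | f a = g a]) ->
  R f g -> f <> g -> forall f' g', A f' -> A g' -> R f' g'.
Proof.
move=> fieldS mG eG eqG Rfg fg; have [Af Ag] := RA Rfg.
have [O [O0 [oO OE]]] : exists O : set G, O !=set0 /\ (open O /\ forall x, O x -> f x <> g x).
  apply: contrapT => nO; apply: (eqG f g Af Ag fg) => O O0 oO.
  apply: contrapT => nE; apply: nO; exists O; do 2 split=> //.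
  by move=> x Ox fgx; apply: nE; exists x.
case: O0 => a0 Oa0; have [B [bB Ba0 BO]] := cob_base ampleG oO Oa0.
have [_ oB _ _] := (compact_open_bisectionE ampleG B).1 bB.
have bB' := cob_inv ampleG bB.
(* Translation by the inverse of [B] carries the values on [B] to the units [s b]. *)
have trans h b : B b -> conv Gd (cind 1 (ginv Gd @^-1` B)) h (s b) = h b :> S.
  move=> Bb; rewrite (@conv_cindT _ _ _ ampleG _ _ _ b^v) ?mul1r//.
  - by rewrite ginvK gmul_src.
  - by rewrite /= ginvK.
  - by rewrite grng_inv grng_src.
have := Rmull (steinberg_cind 1 bB') Rfg.
set f1 := conv Gd _ f; set g1 := conv Gd _ g => R1.
have [Af1 Ag1] := RA R1.
have [||_ [b _ <-]|W1 [a [oW1 W10 W1B fa]]] :=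
  @steinberg_corner _ _ _ ampleG f1 eG Af1 (s @` B).
- exact: open_src.
- by exists (s a0); exists a0.
- exact: unit_space_src.
have W1X : W1 `<=` X by move=> z /W1B [b _ <-]; exact: unit_space_src.
have [W [b [oW [x Wx] WW1 gb]]] := steinberg_corner ampleG eG Ag1 oW1 W10 W1X.
have WX : W `<=` X := subset_trans WW1 W1X.
have [K [cK oK Kx KX KW]] := compact_open_unit_base ampleG (WX _ Wx) oW Wx.
have bK := cob_units ampleG cK oK KX.
have AK c := steinberg_cind (c : S) bK.
have corner (h : G -> S) c : (forall d, K (s d) -> K (r d) -> h d = cind c X d) ->
    conv Gd (conv Gd (cind 1 K) h) (cind 1 K) = cind c K.
  move=> hc; apply/funext => d; rewrite -conv_op conv_unitl ?unit_space_op//; last first.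
    exact: ample_op.
  rewrite mul1r conv_unitl// mul1r /=.
  have [Ks|nKs] := pselect (K (s d)); last first.
    rewrite asboolF// cindF// => Kd; apply: nKs.
    by have := KX _ Kd; rewrite /unit_space /= => ->.
  rewrite asboolT//; have [Kr|nKr] := pselect (K (r d)); last first.
    by rewrite asboolF// cindF// => Kd; apply: nKr; rewrite (rng_unit (KX _ Kd)).
  rewrite asboolT// hc//; apply: cind_iff; split; last exact: KX.
  by rewrite /unit_space /= => <-.
have Rab : R (cind a K) (cind b K).
  have := Rmulr (AK 1) (Rmull (AK 1) R1); rewrite (corner f1 a) ?(corner g1 b)//.
    by move=> d /KW Ws /KW Wr; exact: gb.
  by move=> d /KW/WW1 Ws /KW/WW1 Wr; exact: fa.
(* The unit [x] is the source of some [c] in [B], so [a] and [b] are the values of [f] and [g] at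
   [c], a point of [O]. *)
have nab : a <> b.
  have Xx := WX _ Wx; have srx : s x = x /\ r x = x by split=> //; exact: rng_unit.
  have f1x : f1 x = a by rewrite fa ?srx.1 ?srx.2 ?cindT//; exact: WW1.
  have g1x : g1 x = b by rewrite gb ?srx.1 ?srx.2 ?cindT.
  have [c Bc cx] := W1B _ (WW1 _ Wx).
  move=> ab; apply: (OE c (BO _ Bc)).
  by rewrite -(trans f c Bc) -(trans g c Bc) cx -/f1 -/g1 f1x g1x.
(* In a field, subtract [b] and divide by [a - b]; in the Boolean case [a] and [b] are 0 and 1 in
   some order. *)
have R0 : R (cind 1 K) z0.
  case: fieldS => [[opp inv]|[phi [/bij_inj phiI phi0 phi1 _ _]]].
    have [b' bb'] := opp b.
    have sumK c d : (fun y => cind c K y + cind d K y) = cind (c + d) K.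
      by apply/funext => y; rewrite /cind; case: ifP; rewrite ?addr0.
    have := Radd (AK b') Rab; rewrite !sumK bb' cind0 => Rd.
    have [|e de] := inv (a + b').
      apply/eqP => ab'; apply: nab.
      by rewrite -[LHS]addr0 -bb' (addrC b) addrA ab' add0r.
    have := congruence_left0 (AK e) Rd; rewrite conv_units// mulrC de.
    by rewrite setIid.
  have vals (c : S) : c = 0 \/ c = 1.
    by case E : (phi c); [right|left]; apply: phiI; rewrite E.
  case: (vals a) (vals b) Rab nab => -> [] -> //; rewrite cind0 // => Rab _.
  exact: Rsym.
by apply: (@congruence_full K) => //; exists x.
Qed.

End SimplicitySufficientMain.

(** * Necessity *)

Section NecessaryTransfer.
Variables (G : topologicalType) (S : comNzSemiRingType) (Gd : groupoid G).
Hypothesis ampleG : ample Gd.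
Notation A := (steinberg Gd S).
Notation cob := (compact_open_bisection Gd).
Notation s := (gsrc Gd).
Notation r := (grng Gd).
Notation X := (unit_space Gd).
Notation "a \*g b" := (gmul Gd a b) (at level 40, left associativity).
Notation "a ^v" := (ginv Gd a) (at level 3, format "a ^v").

(** Agreement on a dense open set, phrased so that transitivity follows by shrinking twice. *)
Definition generically_equal (f g : G -> S) :=
  forall O : set G, open O -> O !=set0 ->
    exists O' : set G, [/\ open O', O' !=set0, O' `<=` O & forall x, O' x -> f x = g x].

Lemma generically_equal_conv c U f g : cob U -> generically_equal f g ->
  generically_equal (conv Gd (cind c U) f) (conv Gd (cind c U) g).
Proof.
move=> bU fg O oO O0; have [_ oU _ _] := (compact_open_bisectionE ampleG U).1 bU.
have [[x [Ox [a Ua ax]]]|nO] := pselect ((O `&` r @^-1` (r @` U)) !=set0); last first.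
  exists O; split=> // x Ox.
  by rewrite !conv_cindF// => a Ua ax; apply: nO; exists x; split=> //; exists a.
(* [O] is moved by the inverse of [U], a smaller open set of agreement is found there, and [U] moves
   it back. *)
have [||O1 [oO1 [y O1y] O1O fgO1]] := fg (bmul Gd (ginv Gd @^-1` U) O).
- by apply: open_bmul => //; exact: cob_inv.
- exists (a^v \*g x), a^v; rewrite /= ginvK gmulVK//; split=> //.
  by rewrite grng_mul// gsrc_inv.
exists (bmul Gd U O1); split.
- exact: open_bmul.
- have [b [Ub by_ Oby]] := O1O _ O1y; have sby : s b^v = r y by rewrite gsrc_inv.
  by exists (b^v \*g y), b^v; rewrite ginvK gmulVK ?grng_mul ?ginvK.
- move=> z [b [Ub bz /[dup] O1bz /O1O [d [Ud dbz Odbz]]]].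
  suff db : d^v = b by move: Odbz; rewrite db gmulVK.
  apply: (cob_src_inj ampleG bU) => //; rewrite gsrc_inv dbz grng_mul ?grng_inv//.
  by rewrite gsrc_inv.
- move=> z [b [Ub bz O1bz]]; rewrite !(conv_cindT ampleG _ _ bU Ub bz).
  by rewrite fgO1.
Qed.

(** Constancy is claimed only on some smaller open set: when [G] is not Hausdorff, a compact open
    bisection need not be closed. *)
Lemma steinberg_locally_constant f : A f -> forall O : set G, open O -> O !=set0 ->
  exists O' a, [/\ open O', O' !=set0, O' `<=` O & forall x, O' x -> f x = a].
Proof.
move: f; apply: steinberg_ind => [O oO O0|f c U Af IH bU O oO O0]; first by exists O, 0; split.
have [O1 [a [oO1 O10 O1O fa]]] := IH O oO O0.
have [_ oU _ _] := (compact_open_bisectionE ampleG U).1 bU.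
have [[u [Ou Uu]]|nU] := pselect ((O1 `&` U) !=set0).
  exists (O1 `&` U), (a + c); split; [exact: openI|by exists u|by move=> z [/O1O]|].
  by move=> x [Ox Ux]; rewrite cindT// fa.
exists O1, a; split=> // x Ox; rewrite fa// cindF ?addr0// => Ux.
by apply: nU; exists x.
Qed.

(** Both functions are constant on a small open set, and density supplies one point there at which
    the constants agree. *)
Lemma dense_generically_equal f g : A f -> A g -> dense [set a | f a = g a] ->
  generically_equal f g.
Proof.
move=> Af Ag dfg O oO O0.
have [O1 [a [oO1 O10 O1O fa]]] := steinberg_locally_constant Af oO O0.
have [O2 [b [oO2 O20 O2O1 gb]]] := steinberg_locally_constant Ag oO1 O10.
exists O2; split=> //; first exact: subset_trans O1O.
have [x [O2x fgx]] := dfg O2 O20 oO2; rewrite /= in fgx.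
by move=> y Oy; rewrite (fa _ (O2O1 _ Oy)) gb// -(fa _ (O2O1 _ O2x)) fgx gb.
Qed.

(** The product at [b] reads [f] at an arrow whose range is [s a], and invariance keeps [s a]
    outside [D] whenever [r a = r b] is. *)
Lemma restriction_conv (D : set G) (c : S) U f g : cob U ->
  (forall a, D (s a) <-> D (r a)) -> (forall a, ~ D (r a) -> f a = g a) ->
  forall a, ~ D (r a) -> conv Gd (cind c U) f a = conv Gd (cind c U) g a.
Proof.
move=> bU Dinv fg b nDb.
have [[a [Ua ab]]|na] := pselect (exists a, U a /\ r a = r b); last first.
  by rewrite !conv_cindF// => a Ua ab; apply: na; exists a.
rewrite !(conv_cindT ampleG _ _ bU Ua ab) fg// => /Dinv; rewrite gsrc_mul ?gsrc_inv//.
by move=> /Dinv.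
Qed.

Lemma support_conv (c : S) U f g : cob U ->
  (forall x y : S, x * y = 0 -> x = 0 \/ y = 0) -> (forall a, f a = 0 <-> g a = 0) ->
  forall a, conv Gd (cind c U) f a = 0 <-> conv Gd (cind c U) g a = 0.
Proof.
move=> bU integral fg b.
have [[a [Ua ab]]|na] := pselect (exists a, U a /\ r a = r b); last first.
  by rewrite !conv_cindF// => a Ua ab; apply: na; exists a.
rewrite !(conv_cindT ampleG _ _ bU Ua ab).
by split=> /integral [->|/fg ->]; rewrite ?mul0r ?mulr0.
Qed.

(* Summing over the arrows from [y] to [x] is the quotient map onto the
   functions on the orbit equivalence relation. *)
Definition arrow_sum (f : G -> S) x y := \sum_(a \in [set a | r a = x /\ s a = y]) f a.

Lemma finite_arrows f x y : A f ->
  finite_set ([set a | r a = x /\ s a = y] `&` [set a | f a <> 0]).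
Proof.
move=> Af; apply: sub_finite_set (finite_rng_fibre ampleG x Af).
by move=> a [[]].
Qed.

Lemma arrow_sumD f g x y : A f -> A g ->
  arrow_sum (fun a => f a + g a) x y = arrow_sum f x y + arrow_sum g x y.
Proof. by move=> Af Ag; rewrite /arrow_sum fsumD//; exact: finite_arrows. Qed.

(** Left multiplication by [a] is a bijection from the arrows [y] to [s a] onto the arrows [y] to
    [r a]. *)
Lemma arrow_sum_convT c U f a y : cob U -> A f -> U a ->
  arrow_sum (conv Gd (cind c U) f) (r a) y = c * arrow_sum f (s a) y.
Proof.
move=> bU Af Ua; rewrite /arrow_sum.
rewrite (full_fsbig_distrr +%R c); last exact: finite_arrows.
rewrite (@reindex_fsbig _ _ _ _ _ (fun b => a \*g b) [set b | r b = s a /\ s b = y]).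
  apply: eq_fsbigr => b; rewrite inE => -[ba _].
  by rewrite (@conv_cindT _ _ _ ampleG _ _ _ a)// ?gmulK// grng_mul.
split.
- by move=> b [ba <-] /=; rewrite grng_mul// gsrc_mul.
- move=> b b'; rewrite !inE => -[ba _] [b'a _] e.
  by rewrite -(gmulK (esym ba)) e gmulK.
- move=> d [ad <-]; exists (a^v \*g d); last by rewrite gmulVK.
  by split; rewrite ?grng_mul ?gsrc_mul ?gsrc_inv ?grng_inv.
Qed.

Lemma arrow_sum_convF c U f x y : (forall a, U a -> r a <> x) ->
  arrow_sum (conv Gd (cind c U) f) x y = 0.
Proof.
by move=> nU; apply: fsbig1 => b [bx _]; apply: conv_cindF => a Ua; rewrite bx; exact: nU.
Qed.

Lemma arrow_sum_conv c U f g : cob U -> A f -> A g ->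
  (forall x y, arrow_sum f x y = arrow_sum g x y) ->
  forall x y, arrow_sum (conv Gd (cind c U) f) x y = arrow_sum (conv Gd (cind c U) g) x y.
Proof.
move=> bU Af Ag fg x y.
have [[a [Ua <-]]|na] := pselect (exists a, U a /\ r a = x).
  by rewrite !arrow_sum_convT// fg.
by rewrite !arrow_sum_convF// => a Ua ax; apply: na; exists a.
Qed.

Lemma arrow_sum_cindT c U a : cob U -> U a -> arrow_sum (cind c U) (r a) (s a) = c.
Proof.
move=> bU Ua; rewrite /arrow_sum -(@fsbig_widen _ S 0 +%R [set a]).
- by rewrite fsbig_set1 cindT.
- by move=> _ ->.
- move=> b [[ba _] nb] /=; rewrite cindF// => Ub.
  by apply: nb; exact: (cob_rng_inj ampleG bU).
Qed.

Lemma arrow_sum_cindF c U x y : (forall a, U a -> r a = x -> s a <> y) ->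
  arrow_sum (cind c U) x y = 0.
Proof.
move=> nU; apply: fsbig1 => a [ax ay]; rewrite cindF// => Ua; exact: (nU a).
Qed.


End NecessaryTransfer.

Lemma arrow_sum_op (G : topologicalType) (S : comNzSemiRingType) (Gd : groupoid G)
    (f : G -> S) x y :
  arrow_sum (gop Gd) f x y = arrow_sum Gd f y x.
Proof. by rewrite /arrow_sum; apply: eq_fsbigl; apply/seteqP; split=> z []. Qed.

(** * Consequences of simplicity, one congruence for each condition *)

Section SimplicityNecessary.
Variables (G : topologicalType) (S : comNzSemiRingType) (Gd : groupoid G).
Hypothesis ampleG : ample Gd.
Notation A := (steinberg Gd S).
Notation cob := (compact_open_bisection Gd).
Notation s := (gsrc Gd).
Notation r := (grng Gd).
Notation X := (unit_space Gd).

Hypothesis simpleG : congruence_simple A (fun f g x => f x + g x) (conv Gd).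

Let cob_op U : compact_open_bisection (gop Gd) U -> cob U.
Proof. by move/compact_open_bisection_op. Qed.

(** The common pattern of the necessity arguments: restricted to the algebra, [E] is a congruence,
    and the bisection [U] shows that it is not full, so simplicity makes it the diagonal. *)
Lemma simple_separates (E : (G -> S) -> (G -> S) -> Prop) :
  (forall f, E f f) -> (forall f g, E f g -> E g f) ->
  (forall f g h, E f g -> E g h -> E f h) ->
  (forall f g h, A f -> A g -> A h -> E f g ->
     E (fun x => f x + h x) (fun x => g x + h x)) ->
  (forall c U f g, cob U -> A f -> A g -> E f g ->
     E (conv Gd (cind c U) f) (conv Gd (cind c U) g)) ->
  (forall c U f g, compact_open_bisection (gop Gd) U -> A f -> A g -> E f g ->
     E (conv (gop Gd) (cind c U) f) (conv (gop Gd) (cind c U) g)) ->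
  forall U, cob U -> ~ E (cind 1 U) (fun=> 0) ->
  forall f g, A f -> A g -> E f g -> f = g.
Proof.
move=> Er Es Et Ea El Eri U bU nE f g Af Ag Efg.
pose R f g := [/\ A f, A g & E f g].
have [|full|diag] := simpleG (R := R); last by apply: diag.
  apply: (is_congruence_cind ampleG); rewrite /R.
  - by move=> f1 g1 [].
  - by [].
  - by move=> f1 g1 [? ? /Es].
  - by move=> f1 g1 h [? ? fg] [? ? gh]; split=> //; exact: Et gh.
  - by move=> f1 g1 h Ah [? ? fg]; split; [exact: steinbergD|exact: steinbergD|exact: Ea].
  - move=> c V f1 g1 bV [Af' Ag' fg]; have AV := steinberg_cind c bV.
    by split; [exact: steinberg_conv|exact: steinberg_conv|exact: El].
  - move=> c V f1 g1 bV [Af' Ag' fg]; have AV := steinberg_cind c (cob_op bV).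
    split; last exact: Eri.
      by rewrite conv_op; exact: steinberg_conv.
    by rewrite conv_op; exact: steinberg_conv.
exfalso; apply: nE.
by have [] := full _ _ (steinberg_cind 1 bU) (steinberg0 S Gd).
Qed.

Lemma simple_dense_eq f g : A f -> A g -> f <> g -> ~ dense [set a | f a = g a].
Proof.
move=> Af Ag fg dfg; apply: fg; have Efg := dense_generically_equal ampleG Af Ag dfg.
have [[a fa]|f0] := pselect (exists a, f a <> g a); last first.
  by apply/funext => a; apply: contrapT => fa; apply: f0; exists a.
have [|U [bU Ua _]] := @cob_base _ _ ampleG a setT openT; first by [].
apply: (@simple_separates (@generically_equal _ S) _ _ _ _ _ _ U bU) => //.
- by move=> h O oO O0; exists O; split.
- move=> h k hk O oO O0; have [O' [? ? ? e]] := hk O oO O0.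
  by exists O'; split=> // x /e.
- move=> h k l hk kl O oO O0; have [O' [oO' O'0 O'O e]] := hk O oO O0.
  have [O2 [? ? O2O' e2]] := kl O' oO' O'0.
  exists O2; split=> // [x /O2O'/O'O //|x O2x].
  by rewrite e ?e2//; exact: O2O'.
- move=> h k l _ _ _ hk O oO O0; have [O' [? ? ? e]] := hk O oO O0.
  by exists O'; split=> // x /e ->.
- by move=> c V h k bV _ _; exact: generically_equal_conv.
- by move=> c V h k bV _ _; apply: generically_equal_conv => //; exact: ample_op.
move=> U0; have [_ oU _ _] := (compact_open_bisectionE ampleG U).1 bU.
have [|O [_ [x Ox] OU /(_ x Ox)]] := U0 U oU; first by exists a.
by rewrite (cindT _ (OU _ Ox)) => /eqP; rewrite oner_eq0.
Qed.

Lemma simple_minimal : minimal Gd.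
Proof.
move=> D DX [V [oV DV]] Dinv.
have oD : open D by rewrite DV; apply: openI => //; exact: open_unit_space.
have Dinv2 a : D (s a) <-> D (r a).
  split; first exact: Dinv.
  by move=> Dr; have := @Dinv (ginv Gd a); rewrite gsrc_inv grng_inv; exact.
have [[d Dd]|D0] := pselect (D !=set0); last first.
  by left; apply/seteqP; split=> // x Dx; apply: D0; exists x.
right; apply/seteqP; split=> // x Xx; apply: contrapT => nDx.
have [U [bU Ux _]] := cob_base ampleG openT (I : setT x).
have [W [bW Wd WD]] := cob_base ampleG oD Dd.
(* Agreement off [D] identifies the indicator of [W] with 0, as [W] lies in [D], but not that of
   [U], which takes the value 1 at [x] outside [D]. *)
have : cind 1 W = (fun=> 0) :> (G -> S).
  apply: (@simple_separates (fun f g => forall a, ~ D (r a) -> f a = g a)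
    _ _ _ _ _ _ U bU) => //.
  - by move=> f g fg a /fg.
  - by move=> f g h fg gh a nDa; rewrite fg// gh.
  - by move=> f g h _ _ _ fg a nDa; rewrite fg.
  - by move=> c V' f g bV' _ _ fg; exact: restriction_conv.
  - move=> c V' f g bV' _ _ fg a nDa.
    apply: (restriction_conv (ample_op ampleG) (D := D)) => //=.
    + by move=> b; split=> /Dinv2.
    + by move=> b nDb; apply: fg => /Dinv2.
    + by move=> /Dinv2.
  - move=> /(_ x); rewrite (rng_unit Xx) cindT// => /(_ nDx)/eqP.
    by rewrite oner_eq0.
  - exact: steinberg_cind.
  - exact: steinberg0.
  - by move=> a nDa; rewrite cindF// => /WD Da; apply: nDa; rewrite rng_unit//; exact: DX.
by move/(congr1 (@^~ d)); rewrite cindT// => /eqP; rewrite oner_eq0.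
Qed.

Lemma simple_effective : effective Gd.
Proof.
apply/seteqP; split=> [a|x Xx]; last first.
  rewrite /interior nbhsE; exists X; last by move=> u Xu /=; rewrite rng_unit.
  by split=> //; exact: open_unit_space.
rewrite {1}/interior nbhsE => -[N [oN Na] NI].
have [U [bU Ua UN]] := cob_base ampleG oN Na.
have UI b : U b -> s b = r b by move=> /UN/NI.
have bsU := cob_src ampleG bU.
(* Each arrow [b] of [U] runs from [s b] to itself, so it contributes to the same arrow sum as the
   unit [s b]. Evaluated at [a], the equality shows that [a] is a unit. *)
have E : cind 1 U = cind 1 (s @` U) :> (G -> S).
  apply: (@simple_separates (fun f g => forall x y, arrow_sum Gd f x y = arrow_sum Gd g x y)
    _ _ _ _ _ _ U bU) => //.
  - by move=> f g h fg gh x y; rewrite fg.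
  - by move=> f g h Af Ag Ah fg x y; rewrite !arrow_sumD// fg.
  - by move=> c V f g bV Af Ag fg; exact: arrow_sum_conv.
  - move=> c V f g bV Af Ag fg x y; rewrite -!(arrow_sum_op Gd).
    apply: (arrow_sum_conv (ample_op ampleG)); rewrite ?steinberg_op//.
    by move=> x' y'; rewrite !arrow_sum_op.
  - move=> /(_ (r a) (s a)); rewrite arrow_sum_cindT// (_ : arrow_sum _ _ _ _ = 0).
      by move/eqP; rewrite oner_eq0.
    by apply: fsbig1.
  - exact: steinberg_cind.
  - exact: steinberg_cind.
  move=> x y.
  have [[b [Ub <- <-]]|nb] := pselect (exists b, [/\ U b, r b = x & s b = y]).
    rewrite arrow_sum_cindT// -(UI _ Ub) -{1}(grng_src Gd b) -{2}(gsrc_src Gd b).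
    by rewrite arrow_sum_cindT//; exists b.
  rewrite !arrow_sum_cindF// => [_ [b Ub <-]|b Ub bx by_]; last by apply: nb; exists b.
  by rewrite grng_src gsrc_src => bx by_; apply: nb; exists b; rewrite -UI.
have : (s @` U) a.
  apply: contrapT => na; have := congr1 (@^~ a) E.
  by rewrite cindT// cindF// => /eqP; rewrite oner_eq0.
by move=> [b _ <-]; exact: unit_space_src.
Qed.

(** One nonzero element with an additive inverse gives, by division, inverses to all. Otherwise [S]
    is zero-sum-free without zero divisors, equality of supports is a congruence, and it identifies
    [c] with 1 on [U] for every nonzero [c]. *)
Lemma simple_semifield : [set: G] !=set0 -> semifield S ->
  semiring_is_field S \/ is_boolean_semifield S.
Proof.
move=> [g0 _] sfS.
have [[u [y [/eqP u0 uy]]]|zsf] := pselect (exists x y : S, x <> 0 /\ x + y = 0).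
  left; split=> // x; have [v uv] := sfS u u0.
  (* With [u v = 1] and [u + y = 0], one has [x + x v y = x v (u + y) = 0]. *)
  by exists (x * v * y); rewrite -{1}(mulr1 x) -uv (mulrC u) mulrA -mulrDr uy mulr0.
have zs (x y : S) : x + y = 0 -> x = 0.
  by move=> xy; apply: contrapT => x0; apply: zsf; exists x, y.
have integral (x y : S) : x * y = 0 -> x = 0 \/ y = 0.
  move=> xy; have [->|x0] := eqVneq x 0; first by left.
  by right; have [v xv] := sfS x x0; rewrite -(mul1r y) -xv mulrAC xy mul0r.
have addE (x y : S) : x + y = 0 <-> x = 0 /\ y = 0.
  split=> [xy|[-> ->]]; last by rewrite addr0.
  by split; [exact: zs xy|apply: (zs y x); rewrite addrC].
have [U [bU Ua _]] := cob_base ampleG openT (I : setT g0).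
have ones (c : S) : c <> 0 -> c = 1.
  move=> c0; suff : cind c U = cind 1 U by move/(congr1 (@^~ g0)); rewrite !cindT.
  apply: (@simple_separates (fun f g => forall a, f a = 0 <-> g a = 0)
    _ _ _ _ _ _ U bU) => //.
  - by move=> f g fg a; split=> /fg.
  - by move=> f g h fg gh a; split=> [/fg/gh|/gh/fg].
  - move=> f g h _ _ _ fg a; split=> /addE[f0 h0]; apply/addE; split=> //; exact/fg.
  - by move=> d V f g bV _ _ fg; exact: support_conv.
  - by move=> d V f g bV _ _ fg; apply: support_conv => //; exact: ample_op.
  - by move=> /(_ g0); rewrite cindT// => -[_ /(_ erefl)] /eqP; rewrite oner_eq0.
  - exact: steinberg_cind.
  - exact: steinberg_cind.
  - move=> a; have [Ua'|nU] := pselect (U a); last by rewrite !cindF.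
    by rewrite !cindT//; split=> [//|/eqP]; rewrite oner_eq0.
right; exists (fun x => x != 0); split.
- exists (fun b : bool => b%:R : S) => [x|[]] /=; rewrite ?eqxx ?oner_neq0//.
  by have [->|/eqP/ones ->] := eqVneq x 0.
- by rewrite eqxx.
- exact: oner_neq0.
- move=> x y; apply/idP/orP => [xy|].
    have [x0|] := eqVneq x 0; last by left.
    by right; move: xy; rewrite x0 add0r.
  by move=> [] /eqP n; apply/eqP => /addE [].
- move=> x y; apply/idP/andP => [xy|[/eqP x0 /eqP y0]].
    by split; apply: contraNneq xy => ->; rewrite ?mul0r ?mulr0.
  by apply/eqP => /integral [].
Qed.

End SimplicityNecessary.

Theorem theorem3p8 (G : topologicalType) (Gd : groupoid G)
    (S : comNzSemiRingType) :
  ample Gd -> @second_countable G -> [set: G] !=set0 -> semifield S ->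
  (congruence_simple (steinberg Gd S) (fun f g x => f x + g x) (conv Gd)
   <->
   [/\ semiring_is_field S \/ is_boolean_semifield S,
       minimal Gd /\ effective Gd &
       forall f g : G -> S, steinberg Gd S f -> steinberg Gd S g -> f <> g ->
         ~ dense [set a | f a = g a]]).
Proof.
move=> ampleG _ G0 sfS; split=> [simpleG|[fieldS [mG eG] eqG] R congR].
  split; first exact: (simple_semifield ampleG simpleG).
    by split; [exact: simple_minimal simpleG|exact: simple_effective simpleG].
  by move=> f g; exact: (simple_dense_eq ampleG simpleG).
have [[f [g [Rfg fg]]]|diag] := pselect (exists f g, R f g /\ f <> g).
  by left; exact: (congruence_full_of_neq ampleG congR fieldS mG eG eqG Rfg fg).
by right=> f g Rfg; apply: contrapT => fg; apply: diag; exists f, g.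
Qed.
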